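(* Let $k\ge r\ge 3$ and $n\ge 4k^{r(r+1)}$ be integers, and let $\mathcal{F}\subseteq\binom{[n]}{k}$ be $r$-wise intersecting. Then the number of $(r+1)$-triangles in $\mathcal{F}$ is at most $n_{r+1,k}$, and equality holds if and only if $\mathcal{F}'_{X,k}\subseteq\mathcal{F}\subseteq\mathcal{F}_{X,k}$ for some $(r+1)$-subset $X$ of $[n]$.
   Context: $\binom{[n]}{k}$ denotes the family of $k$-element subsets of $[n]$. A family $\mathcal{F}$ is $r$-wise intersecting if $F_1\cap\dots\cap F_r\neq\emptyset$ for all $F_1,\dots,F_r\in\mathcal{F}$. An $m$-triangle is a collection $\mathcal{T}$ of $m$ sets with $\bigcap_{T\in\mathcal{T}}T=\emptyset$ such that any $m-1$ members of $\mathcal{T}$ have nonempty common intersection; the $(r+1)$-triangles in $\mathcal{F}$ are the subfamilies of $\mathcal{F}$ that are $(r+1)$-triangles. For $X\subseteq[n]$, $\mathcal{F}_{X,k}=\{F\in\binom{[n]}{k}:|F\cap X|\ge|X|-1\}$ and $\mathcal{F}'_{X,k}=\{F\in\binom{[n]}{k}:|F\cap X|=|X|-1\}$; $n_{r+1,k}$ is the number of $(r+1)$-triangles in $\mathcal{F}_{X,k}$ for $|X|=r+1$ (independent of the choice of $X$). *)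

(* Defs.v *)
From mathcomp Require Import all_boot fingroup perm.

Set Implicit Arguments.
Unset Strict Implicit.
Unset Printing Implicit Defensive.

(* The ground set [n] is the ordinal type 'I_n. *)
Section Families.
Variable n : nat.
Implicit Types (F T S : {set {set 'I_n}}) (A X : {set 'I_n}).

Definition ksubsets (k : nat) : {set {set 'I_n}} := [set A : {set 'I_n} | #|A| == k].

(* The r members need not be distinct. *)
Definition rwise_intersecting (r : nat) F : Prop :=
  forall f : 'I_r -> {set 'I_n},
    (forall i, f i \in F) -> \bigcap_(i < r) f i != set0.

(* The m members are distinct, since T is a set of sets. *)
Definition is_triangle (m : nat) T : bool :=
  [&& #|T| == m,
      \bigcap_(A in T) A == set0
    & [forall S : {set {set 'I_n}},
         (S \subset T) && (#|S| == m - 1) ==> (\bigcap_(A in S) A != set0)]].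

Definition triangles (m : nat) F : {set {set {set 'I_n}}} :=
  [set T : {set {set 'I_n}} | (T \subset F) && is_triangle m T].

Definition famX X (k : nat) : {set {set 'I_n}} :=
  [set A in ksubsets k | #|X| - 1 <= #|A :&: X|].

Definition famX' X (k : nat) : {set {set 'I_n}} :=
  [set A in ksubsets k | #|A :&: X| == #|X| - 1].

End Families.

(* The number of m-triangles in famX X k for an m-subset X of 'I_n, m <= n,
   computed at X = {0, ..., m - 1}; by num_trianglesE, any other m-subset gives
   the same number. *)
Definition num_triangles (n m k : nat) : nat :=
  #|triangles m (famX [set i : 'I_n | i < m] k)|.

Section Independence.
Variable n : nat.
Implicit Types (F T S : {set {set 'I_n}}) (A X Y : {set 'I_n}).

Lemma perm_imset_eqcard X Y :
  #|X| = #|Y| -> exists s : {perm 'I_n}, s @: X = Y.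
Proof.
move=> eXY; pose e (Z : {set 'I_n}) := enum Z ++ enum (~: Z).
have szE Z : size (e Z) = n by rewrite size_cat -!cardE cardsC card_ord.
have memE Z x : x \in e Z by rewrite mem_cat !mem_enum inE orbN.
have uE Z : uniq (e Z).
  rewrite cat_uniq !enum_uniq andbT /=; apply/hasPn => x.
  by rewrite !mem_enum inE.
pose f x := nth x (e Y) (index x (e X)).
have ltf x : index x (e X) < size (e Y) by rewrite (etrans (szE Y) (esym (szE X))) index_mem.
have injf : injective f.
  move=> x y; rewrite /f (set_nth_default x y (ltf y)) => /eqP.
  rewrite nth_uniq // => /eqP E.
  by rewrite -(nth_index x (memE X x)) E nth_index.
exists (perm injf); apply/eqP; rewrite eqEcard card_imset; last exact: perm_inj.
rewrite eXY leqnn andbT; apply/subsetP => _ /imsetP[x xX ->].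
have ix : index x (e X) < size (enum Y).
  by rewrite index_cat mem_enum xX -cardE -eXY cardE index_mem mem_enum.
by rewrite permE /f nth_cat ix -mem_enum mem_nth.
Qed.

Lemma imset_bigcap (s : {perm 'I_n}) T :
  \bigcap_(B in [set s @: A | A : {set 'I_n} in T]) B
    = s @: (\bigcap_(A in T) A).
Proof.
apply/setP => y; rewrite -[y](permKV s).
set x := (s^-1)%g y.
rewrite (mem_imset _ _ (@perm_inj _ s)); apply/bigcapP/bigcapP => H A AT.
  by have := H _ (imset_f _ AT); rewrite (mem_imset _ _ (@perm_inj _ s)).
by case/imsetP: AT => B BT ->; rewrite (mem_imset _ _ (@perm_inj _ s)) H.
Qed.

Lemma triangles_famX_le X Y m k :
  #|X| = #|Y| -> #|triangles m (famX X k)| <= #|triangles m (famX Y k)|.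
Proof.
move=> /perm_imset_eqcard[s sX].
have injs : injective s by exact: perm_inj.
have injS : injective (fun A : {set 'I_n} => s @: A) by exact: imset_inj.
have injT : injective (fun T => [set s @: A | A : {set 'I_n} in T]).
  exact: imset_inj.
have cY : #|Y| = #|X| by rewrite -sX card_imset.
rewrite -(card_imset _ injT); apply: subset_leq_card.
apply/subsetP => _ /imsetP[T + ->]; rewrite !inE.
case/andP => TF /and3P[cT T0 /forallP HT]; apply/andP; split.
  apply/subsetP => _ /imsetP[A AT ->]; have := subsetP TF _ AT.
  by rewrite !inE cY -sX -imsetI ?card_imset //; exact: in2W.
apply/and3P; split; first by rewrite card_imset.
  by rewrite imset_bigcap (eqP T0) imset0.
apply/forallP => S; apply/implyP => /andP[ST cS].
pose S' := [set A in T | s @: A \in S].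
have ES : S = [set s @: A | A : {set 'I_n} in S'].
  apply/setP => B; apply/idP/imsetP => [BS|[A + ->]]; last first.
    by rewrite inE => /andP[].
  case/imsetP: (subsetP ST _ BS) => A AT EB.
  by exists A; rewrite // inE AT -EB.
rewrite ES imset_bigcap imset_eq0; apply: (implyP (HT S')).
rewrite -(card_imset (mem S') injS) -ES cS andbT.
by apply/subsetP => A; rewrite inE => /andP[].
Qed.

Lemma num_trianglesE m k X :
  #|X| = m -> #|triangles m (famX X k)| = num_triangles n m k.
Proof.
move=> cX; have c0 : #|[set i : 'I_n | i < m]| = m.
  have le_mn : m <= n by rewrite -cX -[leqRHS]card_ord max_card.
  rewrite -[RHS](card_ord m) -cardsT.
  have injw : injective (widen_ord le_mn).
    by move=> i j /(congr1 val) /= /val_inj.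
  rewrite -(card_imset _ injw); apply: eq_card => i; rewrite inE.
  apply/idP/imsetP => [im|[j _ ->]]; last exact: (ltn_ord j).
  by exists (Ordinal im); last exact: val_inj.
by apply/eqP; rewrite eqn_leq !triangles_famX_le ?cX ?c0.
Qed.

End Independence.

(* Main.v *)
Require Import Defs.
From mathcomp Require Import all_boot.
From mathcomp Require Import zify.

(* Enlarge F to a maximal r-wise intersecting family G, and call an r-set R full
   if all its k-supersets lie in G.  If some triangle of G has a full r-set in
   each of its members, then the full r-sets have empty intersection; as they
   pairwise meet in at least r - 1 points, they include all r-subsets of some
   (r+1)-set X, and G lies in famX X k.  Otherwise every triangle has a member
   containing no full r-set.  If S has fewer than r points, or is an
   r-set that is not full, some set of at most k points is disjoint from S and
   meets every member of G containing S; branching on its points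
   gives at most k^(r+1) 'C(n-r-1, n-k) such members, and at most k 'C(n-r, n-k)
   members of G through a given (r-1)-set.  A triangle through A is determined by
   an r-subset R of A and, for each x in R, a member through R \ x.  The
   resulting bound is smaller than 'C(n-k-1, k-r)^(r+1), a lower bound for the
   number of triangles of famX X k. *)

Set Implicit Arguments.
Unset Strict Implicit.
Unset Printing Implicit Defensive.

(** * Unions, products and subsets of finite sets *)

Lemma leq_card_bigcup (I T : finType) (P : pred I) (F : I -> {set T}) :
  #|\bigcup_(i | P i) F i| <= \sum_(i | P i) #|F i|.
Proof.
elim/big_rec2: _ => [|i y1 y2 _ le_y]; first by rewrite cards0.
by rewrite (leq_trans (leq_card_setU _ _)) ?leq_add2l.
Qed.

Lemma leq_sum_const (I : finType) (A : {set I}) (F : I -> nat) d :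
  (forall i, i \in A -> F i <= d) -> \sum_(i in A) F i <= #|A| * d.
Proof. by move=> leF; rewrite -sum_nat_const leq_sum. Qed.

Lemma geq_sum_const (I : finType) (A : {set I}) (F : I -> nat) d :
  (forall i, i \in A -> d <= F i) -> #|A| * d <= \sum_(i in A) F i.
Proof. by move=> leF; rewrite -sum_nat_const leq_sum. Qed.

Lemma card_pfamily_prod (aT rT : finType) (y0 : rT) (D : {set aT})
    (F : aT -> {set rT}) :
  #|pfamily y0 D (fun x => mem (F x))| = \prod_(x in D) #|F x|.
Proof.
rewrite card_pfamily foldrE big_map -big_enum /=.
by apply: eq_bigr => x _; apply: eq_card.
Qed.

Lemma card_pfamily_le (aT rT : finType) (y0 : rT) (D : {set aT})
    (F : aT -> {set rT}) d :
  (forall x, x \in D -> #|F x| <= d) ->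
  #|pfamily y0 D (fun x => mem (F x))| <= d ^ #|D|.
Proof. by move=> leF; rewrite card_pfamily_prod -prod_nat_const leq_prod. Qed.

Lemma card_pfamily_ge (aT rT : finType) (y0 : rT) (D : {set aT})
    (F : aT -> {set rT}) d :
  (forall x, x \in D -> d <= #|F x|) ->
  d ^ #|D| <= #|pfamily y0 D (fun x => mem (F x))|.
Proof. by move=> leF; rewrite card_pfamily_prod -prod_nat_const leq_prod. Qed.

Lemma exists_subset_card (T : finType) (B : {set T}) j :
  j <= #|B| -> exists2 A : {set T}, A \subset B & #|A| = j.
Proof.
rewrite -bin_gt0 -cards_draws card_gt0 => /set0Pn[A].
by rewrite inE => /andP[sAB /eqP cA]; exists A.
Qed.

(** * Binomial and power estimates *)

Lemma leq_expl m n e : m <= n -> m ^ e <= n ^ e.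
Proof. by case: e => [|e] le_mn; rewrite ?expn0 ?leq_exp2r. Qed.

Lemma leq_bin_exp n m : 'C(n, m) <= n ^ m.
Proof.
apply: (@leq_trans (n ^_ m)).
  by rewrite -bin_ffact leq_pmulr ?fact_gt0.
elim: m n => [|m IHm] [|n] //; rewrite ffactSS expnS leq_mul //.
by apply: leq_trans (IHm n) _; rewrite leq_expl.
Qed.

(** Unfolding Pascal's rule [d] times adds the terms ['C(m + i, j)] for [i < d], each at most the
    last one. *)
Lemma bin_addl_le m d j :
  'C(m + d, j.+1) <= 'C(m, j.+1) + d * 'C(m + d.-1, j).
Proof.
elim: d => [|d IHd]; first by rewrite addn0 mul0n addn0.
rewrite addnS binS mulSn [_.-1]/= addnCA addnC leq_add2l.
apply: leq_trans IHd _; rewrite leq_add2l leq_mul2l leq_bin2l ?orbT //.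
by rewrite leq_add2l leq_pred.
Qed.

(** The quotient of [a ^ m.+1 - b ^ m.+1] by [a - b] is a sum of [m.+1] products of degree [m], each
    at most [a ^ m] when [b < a]. *)
Lemma exp_leq_sub a b m :
  a ^ m.+1 <= b ^ m.+1 + m.+1 * (a - b) * a ^ m.
Proof.
have [le_ab|lt_ba] := leqP a b.
  by apply: leq_trans (leq_addr _ _); apply: leq_expl.
rewrite -leq_subLR subn_exp mulnAC [m.+1 * _]mulnC mulnC leq_mul2r.
apply/orP; right; rewrite mulnC -[X in X * _](card_ord m.+1) -sum_nat_const.
apply: leq_sum => i _; rewrite /=.
apply: (@leq_trans (a ^ (m - i) * a ^ i)).
  by rewrite leq_mul2l leq_expl ?orbT // ltnW.
by rewrite -expnD subnK // -ltnS.
Qed.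

Lemma cards_setD1 (T : finType) (x : T) (A : {set T}) :
  x \in A -> #|A :\ x| = #|A|.-1.
Proof. by move=> xA; rewrite (cardsD1 x A) xA. Qed.

(** For [r < k], symmetry turns the outer binomials into ['C(n - r, k - r)] and
    ['C(n - r.+1, (k - r).-1)], and [bin_addl_le] applies with [d = (k - r).+1]. *)
Lemma bin_shift_le n k r :
  r <= k -> k < n ->
  'C(n - r, n - k) <= 'C(n - k.+1, k - r) + (k - r).+1 * 'C(n - r.+1, n - k).
Proof.
move=> le_rk lt_kn; have [->|ne_kr] := eqVneq k r.
  by rewrite binn subnn bin0.
have -> : n - k = (n - r) - (k - r) by lia.
rewrite bin_sub; last by lia.
have -> : (n - r) - (k - r) = (n - r.+1) - (k - r).-1 by lia.
rewrite bin_sub; last by lia.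
have := bin_addl_le (n - k.+1) (k - r).+1 (k - r).-1.
rewrite prednK; last by lia.
have -> : n - k.+1 + (k - r).+1 = n - r by lia.
by have -> : n - k.+1 + (k - r).+1.-1 = n - r.+1 by lia.
Qed.

(** [M ^ r.+1] exceeds [M' ^ r.+1] by at most [c * L * M ^ r], while [L / M = (k - r) / (n - r)] is
    so small that [(p + c) * L < M]. Multiply the latter by [M ^ r] and cancel [c * L * M ^ r]. *)
Lemma light_triangles_lt n k r :
  3 <= r -> r <= k -> 4 * k ^ (r * (r + 1)) <= n ->
  k ^ (3 * r + 1) * 'C(n - r.+1, n - k) * 'C(n - r, n - k) ^ r
    < 'C(n - k.+1, k - r) ^ r.+1.
Proof.
move=> le3r le_rk le_n.
set p := k ^ (3 * r + 1); set L := 'C(n - r.+1, _); set M := 'C(n - r, _).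
set M' := 'C(_, k - r).
(* The comparison of exponents, [3 * r + 2 <= r * (r + 1)], needs [3 <= r]. *)
have le_n' : 4 * (k * p) <= n.
  apply: leq_trans le_n; rewrite leq_mul2l -expnS leq_pexp2l //; first by lia.
  by nia.
have le_kkp : k * k <= p by rewrite mulnn leq_pexp2l //; lia.
have lt_kn : k < n by nia.
have eL : (n - r) * L = (k - r) * M.
  have := mul_bin_down (n - r) (n - k).
  by rewrite -subnS (_ : n - r - (n - k) = k - r) //; lia.
have M_gt0 : 0 < M by rewrite bin_gt0; lia.
have leM := bin_shift_le le_rk lt_kn; rewrite -/L -/M -/M' in leM.
(* The factor [r.+1] comes from [exp_leq_sub], the factor [(k - r).+1] from [bin_shift_le]. *)
pose c := r.+1 * (k - r).+1.
have le_c : c <= k * k by rewrite /c; nia.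
have ltM : (p + c) * L < M.
  have : (n - r) * ((p + c) * L) < (n - r) * M.
    rewrite mulnCA eL mulnA ltn_mul2r M_gt0 /=.
    have : (p + c) * (k - r) <= (p + p) * (k - r).
      by rewrite leq_mul2r leq_add2l (leq_trans le_c) ?orbT.
    by nia.
  by rewrite ltn_mul2l => /andP[].
have leMM : M ^ r.+1 <= M' ^ r.+1 + c * L * M ^ r.
  apply: leq_trans (exp_leq_sub M M' r) _.
  by rewrite leq_add2l leq_mul2r /c -mulnA leq_mul2l leq_subLR leM !orbT.
have Mr_gt0 : 0 < M ^ r by rewrite expn_gt0 M_gt0.
have : (p + c) * L * M ^ r < M ^ r.+1 by rewrite expnS ltn_mul2r Mr_gt0.
move=> /leq_trans/(_ leMM).
by rewrite mulnDl mulnDl ltn_add2r.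
Qed.

(** * Triangles through a given set *)

Section Triangles.
Variables n k r : nat.
Implicit Types (F G T Q : {set {set 'I_n}}) (A B C I P R S X : {set 'I_n}).

(* The bound is 'C(n - s, k - s) for s = #|S|, in a form that is 0, not 1, when
   k < s <= n. *)
Lemma card_ksupersets S :
  k <= n -> #|[set A in ksubsets n k | S \subset A]| <= 'C(n - #|S|, n - k).
Proof.
move=> le_kn; have [lt_kS|le_Sk] := ltnP k #|S|.
  rewrite (_ : [set _ in _ | _] = set0) ?cards0 //; apply/setP => A.
  rewrite !inE; apply/negP => /andP[/eqP cA /subset_leq_card].
  by rewrite cA leqNgt lt_kS.
have -> : n - k = (n - #|S|) - (k - #|S|) by lia.
rewrite bin_sub ?leq_sub2r //.
have -> : n - #|S| = #|~: S| by rewrite [RHS]cardsCs setCK card_ord.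
rewrite -cards_draws.
set D := [set A in _ | _]; rewrite -(@card_in_imset _ _ (fun A => A :\: S) (mem D)).
  apply: subset_leq_card; apply/subsetP => _ /imsetP[A + ->].
  rewrite !inE => /andP[/eqP cA sSA].
  by rewrite subsetDr cardsD (setIidPr sSA) cA eqxx.
move=> A B; rewrite !inE => /andP[_ /setIidPr sA] /andP[_ /setIidPr sB] eAB.
by rewrite -(setID A S) -(setID B S) sA sB eAB.
Qed.

(** Take for [x B] a common point of the other members; it is outside [B] because all members
    together have no common point. Each member is thus labelled by a point that it alone avoids. *)
Lemma triangle_witness m T :
  1 < m -> is_triangle m T ->
  exists2 x : {set 'I_n} -> 'I_n,
    (forall B, B \in T -> x B \notin B) &
    (forall B C, B \in T -> C \in T -> C != B -> x B \in C).
Proof.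
move=> m_gt1 /and3P[/eqP cT /eqP T0 /forallP HT].
have exx B : B \in T -> exists z, z \in \bigcap_(C in T :\ B) C.
  move=> BT; apply/set0Pn; apply: (implyP (HT _)).
  by rewrite subD1set; move: (cardsD1 B T); rewrite BT cT => ->; rewrite addKn eqxx.
have [B0 /exx[z0 _]] : exists B, B \in T by apply/card_gt0P; rewrite cT; lia.
exists (fun B => odflt z0 [pick z | z \in \bigcap_(C in T :\ B) C]).
  move=> B BT; case: pickP => [z /= zP|nz]; last first.
    by have [z] := exx B BT; rewrite nz.
  apply/negP => zB; suff: z \in set0 by rewrite inE.
  rewrite -T0; apply/bigcapP => C CT; have [-> //|neCB] := eqVneq C B.
  by apply: (bigcapP zP); rewrite !inE neCB.
move=> B C BT CT neCB; case: pickP => [z /= zP|nz]; last first.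
  by have [z] := exx B BT; rewrite nz.
by apply: (bigcapP zP); rewrite !inE neCB.
Qed.

(* A triangle through A is recovered from an r-subset R of A and, for each x in
   R, its unique member avoiding x, which contains R :\ x. *)
Lemma card_triangles_through F A D :
  0 < r -> A \in F -> F \subset ksubsets n k ->
  (forall S, #|S|.+1 = r -> #|[set B in F | S \subset B]| <= D) ->
  #|[set T in triangles (r + 1) F | A \in T]| <= k ^ r * D ^ r.
Proof.
move=> r_gt0 AF Fk degF.
have cA : #|A| = k by move: (subsetP Fk _ AF); rewrite inE => /eqP.
pose fam R := pfamily set0 R (fun x => mem [set B in F | (R :\ x) \subset B]).
pose tri R := [set A |: [set f x | x in R] | f : {ffun 'I_n -> {set 'I_n}} in fam R].
apply: (@leq_trans #|\bigcup_(R in [set R : {set 'I_n} | R \subset A & #|R| == r]) tri R|).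
  apply: subset_leq_card; apply/subsetP => T.
  rewrite !inE => /andP[/andP[TF triT] AT].
  have [|x xN xI] := triangle_witness _ triT; first by rewrite addn1.
  have cT : #|T| = r.+1 by have /and3P[/eqP-> _ _] := triT; rewrite addn1.
  have x_inj : {in T &, injective x}.
    move=> B C BT CT eBC; apply/eqP/contraT => neBC.
    by move: (xN _ BT); rewrite eBC xI // .
  pose R := x @: (T :\ A).
  have cR : #|R| = r.
    rewrite card_in_imset; last first.
      by move=> B C /setD1P[_ BT] /setD1P[_ CT]; apply: x_inj.
    by rewrite cards_setD1 // cT.
  (* [f z] is the member labelled [z]; the value [set0] off [R] is the support condition of
     [pfamily]. *)
  pose f := [ffun z => if z \in R then odflt set0 [pick B in T | x B == z] else set0].
  have fx B : B \in T -> B != A -> f (x B) = B.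
    move=> BT neBA; rewrite ffunE imset_f ?inE ?neBA //.
    case: pickP => [C /andP[CT /eqP eCB]|/(_ B)]; last by rewrite BT eqxx.
    exact: x_inj.
  apply/bigcupP; exists R.
    rewrite inE cR eqxx andbT; apply/subsetP => _ /imsetP[B + ->].
    by rewrite !inE => /andP[neBA BT]; rewrite xI // eq_sym.
  apply/imsetP; exists f.
    apply/pfamilyP; split.
      by apply/subsetP => z; rewrite inE ffunE; case: ifP => //; rewrite eqxx.
    move=> _ /imsetP[B + ->]; rewrite !inE => /andP[neBA BT].
    rewrite fx // (subsetP TF) //=; apply/subsetP => z.
    rewrite !inE => /andP[nez /imsetP[C + ez]].
    rewrite !inE ez => /andP[neCA CT]; rewrite xI //.
    by apply: contraNneq nez => ->; rewrite ez.
  apply/setP => B; rewrite !inE; have [-> //|neBA] /= := eqVneq B A.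
  apply/idP/imsetP => [BT|[_ /imsetP[C + ->] ->]].
    by exists (x B); rewrite ?fx // imset_f // !inE neBA.
  by rewrite !inE => /andP[neCA CT]; rewrite fx.
apply: leq_trans (leq_card_bigcup _ _) _.
apply: leq_trans (leq_sum_const (d := D ^ r) _) _.
  move=> R; rewrite inE => /andP[_ /eqP cR].
  apply: leq_trans (leq_imset_card _ _) _; rewrite -[X in D ^ X]cR.
  apply: card_pfamily_le => x xR; apply: degF.
  by rewrite cards_setD1 // cR prednK.
by rewrite cards_draws cA leq_mul2r leq_bin_exp orbT.
Qed.

(** * Triangles of [famX X k] *)

(** For each point of [X] choose a member avoiding it. As members miss at most one point of [X], the
    choice is injective on [X], and [#|T| = #|X|] makes it onto. *)
Lemma famX_triangleP X T :
  #|X| = r + 1 -> T \in triangles (r + 1) (famX X k) ->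
  exists2 g : 'I_n -> {set 'I_n}, g @: X = T & {in X, forall x, g x :&: X = X :\ x}.
Proof.
move=> cX; rewrite !inE => /andP[TX /and3P[/eqP cT /eqP T0 _]].
have exg x : exists B, (B \in T) && (x \notin B).
  apply/existsP; apply/contraT; rewrite negb_exists => /forallP xT.
  have: x \in set0; last by rewrite inE.
  rewrite -T0; apply/bigcapP => B BT; move: (xT B).
  by rewrite BT negbK.
pose g x := xchoose (exg x).
have gT x : g x \in T by have /andP[] := xchooseP (exg x).
have gN x : x \notin g x by have /andP[] := xchooseP (exg x).
have trg : {in X, forall x, g x :&: X = X :\ x}.
  move=> x xX; apply/eqP; rewrite eqEcard; apply/andP; split.
    apply/subsetP => z; rewrite !inE => /andP[zg ->]; rewrite andbT.
    by apply: contraTneq zg => ->.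
  move: (subsetP TX _ (gT x)); rewrite inE => /andP[_]; apply: leq_trans.
  by rewrite subn1 cards_setD1 ?leqnn.
exists g => //; apply/eqP; rewrite eqEcard; apply/andP; split.
  by apply/subsetP => _ /imsetP[x _ ->].
rewrite cT -cX card_in_imset // => x y xX yX eg.
have := trg _ xX; rewrite eg trg // => /setP/(_ x).
by rewrite !inE eqxx xX andbT => /negbFE/eqP.
Qed.

(* The sets that may replace X :\ x in a triangle of famX X k through A: by the
   second condition they share with A only points of X. *)
Definition petals X x A : {set {set 'I_n}} :=
  [set B in ksubsets n k | (B :&: X == X :\ x) && (B :&: A \subset X)].

(** Each [(k - r)]-subset [C] of the complement of [X :|: A] yields the petal [X :\ x :|: C]. *)
Lemma card_petals X x A :
  #|X| = r + 1 -> x \in X -> r <= k ->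
  'C(#|~: (X :|: A)|, k - r) <= #|petals X x A|.
Proof.
move=> cX xX le_rk; rewrite -cards_draws.
have cXx : #|X :\ x| = r by rewrite cards_setD1 // cX addn1.
have disj C : C \subset ~: (X :|: A) -> forall z, z \in C -> (z \notin X) && (z \notin A).
  by move=> /subsetP sC z /sC; rewrite !inE negb_or.
rewrite -(@card_in_imset _ _ (fun C => X :\ x :|: C)
  (mem [set C : {set 'I_n} | C \subset _ & _])); last first.
  move=> C C'; rewrite !inE => /andP[sC _] /andP[sC' _] /setP eC.
  apply/setP => z; move: (eC z) (disj _ sC z) (disj _ sC' z).
  rewrite !inE; case: (z \in X); rewrite /= ?andbF //=.
  by case: (z \in C) => [_ /(_ isT)|]; case: (z \in C') => // _ _ /(_ isT).
apply: subset_leq_card; apply/subsetP => _ /imsetP[C + ->].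
rewrite !inE => /andP[sC /eqP cC]; apply/and3P; split.
- rewrite cardsU cXx cC (_ : _ :&: _ = set0) ?cards0 ?subn0 ?subnKC //.
  apply/setP => z; rewrite !inE; apply/negP => /andP[/andP[_ zX] /(disj _ sC)].
  by rewrite zX.
- apply/eqP/setP => z; rewrite !inE; have [zC|] := boolP (z \in C).
    by have /andP[/negPf-> _] := disj _ sC _ zC; rewrite !andbF.
  by rewrite orbF -andbA andbb.
apply/subsetP => z; rewrite !inE => /andP[/orP[/andP[_ ->]//|zC] zA].
by move: (disj _ sC _ zC); rewrite zA andbF.
Qed.

(** [A] misses one point [x0] of [X], and any choice of a petal for each other point of [X]
    completes [A] to a triangle: a point of [X] is avoided by exactly one member, and no point
    outside [X] is common because petals meet [A] inside [X]. *)
Lemma card_famX_triangles_through X A :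
  0 < r -> #|X| = r + 1 -> r <= k -> A \in famX' X k ->
  'C(n - k.+1, k - r) ^ r <= #|[set T in triangles (r + 1) (famX X k) | A \in T]|.
Proof.
move=> r_gt0 cX le_rk; rewrite !inE => /andP[/eqP cA /eqP cAX].
have {}cAX : #|X :&: A| = r by rewrite setIC; lia.
have [x0 /setDP[x0X x0A]] : exists x, x \in X :\: A.
  by apply/card_gt0P; rewrite cardsD cAX cX; lia.
have cXx : #|X :\ x0| = r by rewrite cards_setD1 // cX addn1.
have trA : A :&: X = X :\ x0.
  apply/eqP; rewrite eqEcard cXx setIC cAX leqnn andbT.
  apply/subsetP => z; rewrite !inE => /andP[-> zA]; rewrite andbT.
  by apply: contraTneq zA => ->.
pose fam := pfamily set0 (X :\ x0) (fun x => mem (petals X x A)).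
apply: (@leq_trans #|fam|).
  rewrite -[X in _ ^ X]cXx; apply: card_pfamily_ge => x /setD1P[_ xX].
  apply: leq_trans (card_petals A cX xX le_rk).
  (* [X :|: A] has [k.+1] points, since [A] contains [r] of the [r + 1] points of [X]. *)
  apply: leq_bin2l; rewrite cardsCs setCK card_ord.
  by rewrite leq_sub2l // cardsU cX cA cAX; lia.
have famP f : f \in fam -> forall x, x \in X -> x != x0 ->
  [/\ #|f x| = k, f x :&: X = X :\ x & f x :&: A \subset X].
  move=> /pfamilyP[_ fP] x xX nex; have := fP x; rewrite !inE xX nex.
  by move=> /(_ isT)/and3P[/eqP ? /eqP ? ?].
have trN f x y : f \in fam -> y \in X -> y != x0 -> x \in X -> (x \in f y) = (x != y).
  move=> fF yX ney xX; have [_ /setP/(_ x) + _] := famP f fF y yX ney.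
  by rewrite !inE xX !andbT.
have trAN x : x \in X -> (x \in A) = (x != x0).
  by move=> xX; have /setP/(_ x) := trA; rewrite !inE xX !andbT.
pose tri (f : {ffun 'I_n -> {set 'I_n}}) := A |: [set f x | x in X :\ x0].
have f_inj f : f \in fam -> {in X :\ x0 &, injective f}.
  move=> fF x y /setD1P[nex xX] /setD1P[ney yX] exy; apply/eqP/contraT => nexy.
  have := trN f x x fF xX nex xX; rewrite exy trN // eqxx.
  by rewrite nexy.
have f_ne f x : f \in fam -> x \in X -> x != x0 -> f x != A.
  move=> fF xX nex; apply/negP => /eqP efA.
  by have := trN f x0 x fF xX nex x0X; rewrite efA (negPf x0A) eq_sym nex.
have AN f : f \in fam -> A \notin [set f x | x in X :\ x0].
  move=> fF; apply/imsetP => -[x /setD1P[nex xX] eA].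
  by have := f_ne f x fF xX nex; rewrite -eA eqxx.
(* The choice can be read off the triangle: [f x] is its only member avoiding [x]. *)
rewrite -(@card_in_imset _ _ tri (mem fam)) => [|f g fF gF /setP etri]; last first.
  have /pfamilyP[/subsetP sf _] := fF; have /pfamilyP[/subsetP sg _] := gF.
  apply/ffunP => x; have [/setD1P[nex xX]|xD] := boolP (x \in X :\ x0); last first.
    move: (sf x) (sg x); rewrite !inE in xD *; rewrite (negPf xD).
    by case: eqP => [->|_ /(_ isT)//] _; case: eqP => [->|_ /(_ isT)].
  have := etri (f x); rewrite !inE (negPf (f_ne f x fF xX nex)) imset_f ?inE ?nex //=.
  move=> /esym/imsetP[y /setD1P[ney yX] efg].
  have [eyx|nexy] := eqVneq y x; first by rewrite efg eyx.
  have := trN f x x fF xX nex xX; rewrite efg trN // eqxx.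
  by rewrite eq_sym nexy.
apply: subset_leq_card; apply/subsetP => _ /imsetP[f fF ->].
have AfX : A \in famX X k by rewrite !inE cA eqxx cX setIC cAX; lia.
have triE B : B \in tri f -> exists2 x, x \in X & forall z, z \in X -> (z \in B) = (z != x).
  rewrite !inE => /orP[/eqP->|/imsetP[x /setD1P[nex xX] ->]].
    by exists x0 => // z zX; rewrite trAN.
  by exists x => // z zX; rewrite trN.
have tri_uniq B C x : B \in tri f -> C \in tri f -> x \in X -> x \notin B -> x \notin C -> B = C.
  rewrite !inE => /orP[/eqP->|/imsetP[y /setD1P[ney yX] ->]].
    move=> /orP[/eqP->//|/imsetP[z /setD1P[nez zX] ->]] xX.
    by rewrite trAN // trN // !negbK => /eqP-> /eqP ezz; rewrite ezz eqxx in nez.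
  move=> /orP[/eqP->|/imsetP[z /setD1P[nez zX] ->]] xX.
    by rewrite trAN // trN // !negbK => /eqP-> /eqP ezz; rewrite ezz eqxx in ney.
  by rewrite !trN // !negbK => /eqP<- /eqP->.
rewrite !inE eqxx andbT; apply/andP; split.
  apply/subsetP => B; rewrite !inE => /orP[/eqP->|/imsetP[x /setD1P[nex xX] ->]].
    by move: AfX; rewrite !inE.
  have [-> tr _] := famP f fF x xX nex; rewrite eqxx tr.
  by rewrite subn1 cards_setD1 ?leqnn.
apply/and3P; split.
- rewrite cardsU1 card_in_imset ?cXx; last exact: f_inj.
  by rewrite AN // add1n addn1.
- apply/eqP/setP => z; rewrite inE; apply/negbTE/negP => /bigcapP zT.
  have zA : z \in A by apply: zT; rewrite !inE eqxx.
  have fT x : x \in X -> x != x0 -> f x \in tri f.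
    by move=> xX nex; rewrite !inE imset_f ?orbT // !inE nex.
  have [zX|zX] := boolP (z \in X).
    have nez : z != x0 by rewrite -trAN.
    by have := zT _ (fT z zX nez); rewrite trN // eqxx.
  have [x /setD1P[nex xX]] : exists x, x \in X :\ x0.
    by apply/card_gt0P; rewrite cXx.
  have [_ _ /subsetP/(_ z)] := famP f fF x xX nex.
  by rewrite inE zA zT ?fT // (negPf zX) => /(_ isT).
apply/forallP => S; apply/implyP => /andP[ST cS]; apply/set0Pn.
(* [S] omits some member [B], and the point of [X] that [B] avoids lies in every other member. *)
have [B BT BS] : exists2 B, B \in tri f & B \notin S.
  apply/subsetPn; apply/negP => /subset_leq_card.
  rewrite cardsU1 card_in_imset ?cXx; last exact: f_inj.
  by rewrite (eqP cS) AN // add1n addnK ltnn.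
have [x xX xB] := triE _ BT; exists x; apply/bigcapP => C CS.
apply/contraT => xC; rewrite (_ : B = C) ?CS // in BS.
apply: (tri_uniq B C x) => //; first exact: (subsetP ST).
by rewrite xB // eqxx.
Qed.

(** Double counting of pairs of a triangle and a member [A] with trace [X :\ x0]: there are at least
    [m] such sets [A], each in at least [m ^ r] triangles, and a triangle has at most one such
    member. With [set0] as last argument, [petals] only prescribes the size and the trace. *)
Lemma card_famX_triangles X :
  0 < r -> #|X| = r + 1 -> r <= k ->
  'C(n - k.+1, k - r) ^ r.+1 <= #|triangles (r + 1) (famX X k)|.
Proof.
move=> r_gt0 cX le_rk.
have [x0 x0X] : exists x, x \in X by apply/card_gt0P; rewrite cX addn1.
have cXx : #|X :\ x0| = r by rewrite cards_setD1 // cX addn1.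
set m := 'C(_, _); pose P := petals X x0 set0.
have leP : m <= #|P|.
  apply: leq_trans (card_petals _ cX x0X le_rk); apply: leq_bin2l.
  by rewrite setU0 cardsCs setCK card_ord cX leq_sub2l // addn1.
rewrite expnS (leq_trans (leq_mul leP (leqnn _))) //.
have thrP A : A \in P -> m ^ r <= \sum_(T in triangles (r + 1) (famX X k)) (A \in T).
  rewrite inE => /and3P[kA /eqP trA _].
  have AX' : A \in famX' X k by rewrite inE kA trA cXx cX addnK eqxx.
  apply: leq_trans (card_famX_triangles_through r_gt0 cX le_rk AX') _.
  rewrite -sum1_card big_mkcond [leqRHS]big_mkcond /=.
  by apply: leq_sum => T _; rewrite inE; case: (T \in _); case: (A \in T).
apply: leq_trans (geq_sum_const thrP) _; rewrite exchange_big /= -sum1_card.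
apply: leq_sum => T /(famX_triangleP cX)[g gT trg].
rewrite -big_mkcondr /= sum1_card; apply/card_le1_eqP => A B.
have inP C : C \in [pred C in P | C \in T] -> C = g x0.
  rewrite !inE => /andP[/and3P[_ /eqP trC _]]; rewrite -gT => /imsetP[x xX eC].
  move: trC; rewrite eC trg // => /setP/(_ x); rewrite !inE eqxx xX /= andbT.
  by move=> /esym/negbFE/eqP ->.
by move=> /inP-> /inP->.
Qed.

Lemma triangles_mono m F G : F \subset G -> triangles m F \subset triangles m G.
Proof.
by move=> sFG; apply/subsetP => T; rewrite !inE => /andP[/subset_trans->].
Qed.

(** By [famX_triangleP], a member of a triangle of [famX X k] misses exactly one point of [X], so it
    lies in [famX' X k]. *)
Lemma triangles_famX'_eq X F :
  #|X| = r + 1 -> famX' X k \subset F -> F \subset famX X k ->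
  triangles (r + 1) F = triangles (r + 1) (famX X k).
Proof.
move=> cX sX'F sFX; apply/eqP; rewrite eqEsubset triangles_mono //=.
apply/subsetP => T TX; have [g gT trg] := famX_triangleP cX TX.
move: TX; rewrite !inE => /andP[TX ->]; rewrite andbT.
apply/subsetP => A AT; apply: (subsetP sX'F); rewrite inE.
move: (subsetP TX _ AT); rewrite inE => /andP[-> _] /=.
by move: AT; rewrite -gT => /imsetP[x xX ->]; rewrite trg // cards_setD1 // subn1.
Qed.

(** The bound of [card_famX_triangles_through] is positive, so each member of [famX' X k] lies in a
    triangle of [famX X k]; equal counts make it a triangle of [F]. *)
Lemma triangles_famX_eqP X F :
  0 < r -> r <= k -> 2 * k < n -> #|X| = r + 1 -> F \subset famX X k ->
  #|triangles (r + 1) F| = #|triangles (r + 1) (famX X k)| -> famX' X k \subset F.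
Proof.
move=> r_gt0 le_rk lt_n cX sFX /eqP eFX; apply/subsetP => A AX'.
have [T] : exists T, T \in [set T in triangles (r + 1) (famX X k) | A \in T].
  apply/card_gt0P; apply: leq_trans (card_famX_triangles_through r_gt0 cX le_rk AX').
  by rewrite expn_gt0 bin_gt0; apply/orP; left; lia.
rewrite inE => /andP[+ AT]; rewrite -(_ : triangles (r + 1) F = triangles _ _).
  by rewrite inE => /andP[/subsetP/(_ A AT)].
by apply/eqP; rewrite eqEcard triangles_mono //= (eqP eFX).
Qed.

(** * Meeting families and their covers *)

(** A boolean form of r-wise intersection, as [maxset] needs: sets of at most [r] members replace
    functions on ['I_r]. *)
Definition meeting F : bool :=
  [forall Q : {set {set 'I_n}}, (Q \subset F) && (#|Q| <= r) ==> (\bigcap_(A in Q) A != set0)].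

Lemma meetingP F Q : meeting F -> Q \subset F -> #|Q| <= r -> exists z, z \in \bigcap_(A in Q) A.
Proof.
by move=> /forallP/(_ Q)/implyP mF sQF cQ; apply/set0Pn/mF; rewrite sQF.
Qed.

Lemma rwise_intersecting_meeting F : 0 < n -> rwise_intersecting r F -> meeting F.
Proof.
move=> n_gt0 rF; apply/forallP => Q; apply/implyP => /andP[sQF cQ].
have [->|/set0Pn[A0 A0Q]] := eqVneq Q set0.
  by rewrite big_set0; apply/set0Pn; exists (Ordinal n_gt0); rewrite inE.
(* [f] enumerates [Q] and repeats [A0] once [Q] is exhausted. *)
pose f (i : 'I_r) := nth A0 (enum Q) i.
have fQ i : f i \in Q.
  rewrite /f; have [lt_i|le_i] := ltnP i (size (enum Q)).
    by rewrite -mem_enum mem_nth.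
  by rewrite nth_default.
have /set0Pn[z /bigcapP zf] := rF f (fun i => subsetP sQF _ (fQ i)).
apply/set0Pn; exists z; apply/bigcapP => A AQ.
have lt_A : index A (enum Q) < size (enum Q) by rewrite index_mem mem_enum.
have lt_Ar : index A (enum Q) < r by apply: leq_trans lt_A _; rewrite -cardE.
by have := zf (Ordinal lt_Ar) isT; rewrite /f nth_index // mem_enum.
Qed.

(* Through a set S covered by I, the members of F can be enumerated by branching
   on a further point, taken in I. *)
Definition covers F S I : Prop :=
  [/\ #|I| <= k, I :&: S = set0 & forall A, A \in F -> A :&: I != set0].

(** The intersection lies in a member of [Q], so it has at most [k] points; [Q] with one more member
    of [F] still has at most [r] members, hence a common point. *)
Lemma covers_bigcap F S Q :
  F \subset ksubsets n k -> meeting F -> Q \subset F -> Q != set0 -> #|Q| < r ->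
  (\bigcap_(A in Q) A) :&: S = set0 -> covers F S (\bigcap_(A in Q) A).
Proof.
move=> Fk mF sQF /set0Pn[B BQ] cQ QS; split => //.
  have := subsetP Fk _ (subsetP sQF _ BQ); rewrite inE => /eqP <-.
  by apply: subset_leq_card; apply: bigcap_inf.
move=> A AF; have [||z zQ] := @meetingP F (A |: Q) mF.
- by rewrite subUset sub1set AF.
- by rewrite cardsU1; apply: leq_trans cQ; rewrite -add1n leq_add2r leq_b1.
by apply/set0Pn; exists z; move: zQ; rewrite bigcap_setU big_set1.
Qed.

Lemma missing_set F :
  \bigcap_(A in F) A = set0 -> exists g : 'I_n -> {set 'I_n}, forall x, g x \in F /\ x \notin g x.
Proof.
move=> F0; have exg x : exists A, (A \in F) && (x \notin A).
  apply/existsP/contraT; rewrite negb_exists => /forallP xF.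
  have: x \in set0; last by rewrite inE.
  by rewrite -F0; apply/bigcapP => A AF; have := xF A; rewrite AF negbK.
by exists (fun x => xchoose (exg x)) => x; have /andP := xchooseP (exg x).
Qed.

(** For each point of [S] take a member of [F] avoiding it: these are fewer than [r] members, and
    their intersection is disjoint from [S]. If [S] is empty, any single member serves. *)
Lemma covers_small F S :
  F \subset ksubsets n k -> meeting F -> 1 < r -> \bigcap_(A in F) A = set0 -> #|S| < r ->
  exists I, covers F S I.
Proof.
move=> Fk mF r_gt1 F0 cS; have [g gP] := missing_set F0.
have [eF|/set0Pn[G0 G0F]] := eqVneq F set0.
  by exists set0; split=> [||A]; rewrite ?cards0 ?set0I // eF inE.
have [eS|/set0Pn[s sS]] := eqVneq S set0.
  exists (\bigcap_(A in [set G0]) A); apply: covers_bigcap; rewrite ?sub1set ?cards1 //.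
    by apply/set0Pn; exists G0; rewrite inE.
  by rewrite eS setI0.
exists (\bigcap_(A in g @: S) A); apply: covers_bigcap => //.
- by apply/subsetP => _ /imsetP[x _ ->]; have [] := gP x.
- by apply/set0Pn; exists (g s); apply: imset_f.
- exact: leq_ltn_trans (leq_imset_card _ _) cS.
apply/setP => x; rewrite inE [RHS]inE; apply/negP => /andP[/bigcapP xg xS].
by have [_ /negP] := gP x; apply; apply/xg/imset_f.
Qed.

(** A member of [G] containing [S] contains [y |: S] for one of at most [k] points [y]. Keeping [G]
    apart from [F] lets light members be counted with covers of the whole family. *)
Lemma degree_step F G S I D :
  G \subset F -> covers F S I ->
  (forall y, y \in I -> #|[set A in G | (y |: S) \subset A]| <= D) ->
  #|[set A in G | S \subset A]| <= k * D.
Proof.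
move=> sGF [cI IS IF] degG.
apply: (@leq_trans #|\bigcup_(y in I) [set A in G | (y |: S) \subset A]|).
  apply: subset_leq_card; apply/subsetP => A; rewrite inE => /andP[AG sSA].
  have /set0Pn[y /setIP[yA yI]] := IF _ (subsetP sGF _ AG).
  by apply/bigcupP; exists y => //; rewrite inE AG subUset sub1set yA.
apply: leq_trans (leq_card_bigcup _ _) _.
by apply: leq_trans (leq_sum_const degG) _; rewrite leq_mul2r cI orbT.
Qed.

Lemma covers_setU1_card F S I y : covers F S I -> y \in I -> #|y |: S| = #|S|.+1.
Proof.
move=> [_ /setP/(_ y) + _] yI; rewrite !inE yI /= => /negbT yS.
by rewrite cardsU1 yS.
Qed.

Lemma card_degree F S :
  F \subset ksubsets n k -> meeting F -> 1 < r -> k <= n -> \bigcap_(A in F) A = set0 ->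
  #|S|.+1 = r -> #|[set A in F | S \subset A]| <= k * 'C(n - r, n - k).
Proof.
move=> Fk mF r_gt1 le_kn F0 cS.
have [|I cov] := covers_small (S := S) Fk mF r_gt1 F0; first by rewrite cS.
apply: (degree_step (subxx F) cov) => y yI.
rewrite -cS -(covers_setU1_card cov yI); apply: leq_trans (card_ksupersets _ le_kn).
apply: subset_leq_card; apply/subsetP => A.
by rewrite !inE => /andP[AF ->]; move: (subsetP Fk _ AF); rewrite inE => ->.
Qed.

(** * Full sets and light members *)

Definition full F R : bool := [set A in ksubsets n k | R \subset A] \subset F.

Definition light F : {set {set 'I_n}} :=
  [set A in F | [forall R : {set 'I_n}, (R \subset A) && (#|R| == r) ==> ~~ full F R]].

Definition maximal_meeting F : bool :=
  maxset (fun F => (F \subset ksubsets n k) && meeting F) F.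

(** Some [k]-superset [A] of [R] is outside [F]. By maximality, [A] and fewer than [r] members of
    [F] have no common point, so the intersection of these members is disjoint from [A], hence from
    [R]. *)
Lemma covers_not_full F R :
  maximal_meeting F -> 0 < k -> ~~ full F R -> exists I, covers F R I.
Proof.
move=> /maxsetP[/andP[Fk mF] maxF] k_gt0 /subsetPn[A].
rewrite inE => /andP[kA sRA] AF.
have /forallPn[Q] : ~~ meeting (A |: F).
  apply: contra AF => mAF; rewrite -(maxF (A |: F)) ?setU11 ?subsetUr //.
  by rewrite subUset sub1set kA Fk.
rewrite negb_imply negbK => /andP[/andP[sQ cQ] /eqP Q0].
have AQ : A \in Q.
  apply/contraT => AQ; have [||z] := @meetingP F Q mF => //; last by rewrite Q0 inE.
  apply/subsetP => B BQ; have := subsetP sQ _ BQ; rewrite !inE => /orP[/eqP eB|//].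
  by rewrite -eB BQ in AQ.
have sQ'F : Q :\ A \subset F by rewrite subDset.
have cQ' : #|Q :\ A| < r.
  by move: cQ; rewrite (cardsD1 A Q) AQ.
have {}Q0 : (\bigcap_(B in Q :\ A) B) :&: A = set0.
  by rewrite -Q0 -[in RHS](setD1K AQ) bigcap_setU big_set1 setIC.
exists (\bigcap_(B in Q :\ A) B); apply: covers_bigcap => //; last first.
  by apply/eqP; rewrite -subset0; apply: subset_trans (setIS _ sRA) _; rewrite Q0.
(* If [Q :\ A] were empty, its intersection would be everything and [A] would be empty, against
   [0 < k]. *)
apply/negP => /eqP eQ; move: Q0; rewrite eQ big_set0 setTI => eA.
by move: kA; rewrite eA inE cards0 => /eqP ek; rewrite -ek in k_gt0.
Qed.

Lemma card_light F :
  maximal_meeting F -> 1 < r -> r <= k -> k <= n -> \bigcap_(A in F) A = set0 ->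
  #|light F| <= k ^ r.+1 * 'C(n - r.+1, n - k).
Proof.
move=> maxF r_gt1 le_rk le_kn F0; have /maxsetP[/andP[Fk mF] _] := maxF.
have sLF : light F \subset F by apply/subsetP => A; rewrite inE => /andP[].
(* [j] counts the points that [S] lacks to be an [r]-set. At [j = 0] a full [S] lies in no light
   member, and a non-full one allows a last branching, to [r.+1] points. *)
suff deg j S : j <= r -> #|S| = r - j ->
    #|[set A in light F | S \subset A]| <= k ^ j.+1 * 'C(n - r.+1, n - k).
  apply: leq_trans (deg r set0 (leqnn r) _); last by rewrite cards0 subnn.
  by apply: subset_leq_card; apply/subsetP => A AL; rewrite inE AL sub0set.
elim: j S => [|j IHj] S le_j cS.
  rewrite subn0 in cS; have [fS|fS] := boolP (full F S).
    rewrite (_ : [set _ in _ | _] = set0) ?cards0 //; apply/setP => A.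
    rewrite !inE; apply/negP => /andP[/andP[_ /forallP/(_ S)]] + sSA.
    by rewrite sSA cS eqxx fS.
  have [I cov] := covers_not_full maxF (leq_trans (ltnW r_gt1) le_rk) fS.
  rewrite expn1; apply: (degree_step sLF cov) => y yI.
  rewrite -cS -(covers_setU1_card cov yI); apply: leq_trans (card_ksupersets _ le_kn).
  apply: subset_leq_card; apply/subsetP => A; rewrite inE => /andP[/(subsetP sLF) AF sA].
  by rewrite inE (subsetP Fk _ AF).
have [|I cov] := covers_small (S := S) Fk mF r_gt1 F0; first by lia.
rewrite expnS -mulnA; apply: (degree_step sLF cov) => y yI.
by apply: IHj; [lia | rewrite (covers_setU1_card cov yI) cS; lia].
Qed.

(** * Structure of the full [r]-sets *)

Lemma ksuperset_avoiding R (Z : {set 'I_n}) :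
  #|R| <= k -> #|R :|: Z| + k <= n ->
  exists A, [/\ A \in ksubsets n k, R \subset A & A :&: Z \subset R].
Proof.
move=> le_Rk le_n; have [|C sC cC] := @exists_subset_card _ (~: (R :|: Z)) (k - #|R|).
  by rewrite [#|~: _|]cardsCs setCK card_ord; lia.
have RC : R :&: C = set0.
  apply/eqP; rewrite -subset0; apply/subsetP => z /setIP[zR /(subsetP sC)].
  by rewrite !inE zR.
exists (R :|: C); split; rewrite ?subsetUl //.
  by rewrite inE cardsU RC cards0 cC; apply/eqP; lia.
apply/subsetP => z; rewrite !inE => /andP[/orP[//|/(subsetP sC)]].
by rewrite !inE negb_or => /andP[_ /negPf->].
Qed.

(** Otherwise choose [k]-supersets [A] of [R] and [A'] of [R'] meeting only inside [R :&: R'], and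
    for each point there a member of [F] avoiding it. These are at most [r] members of [F] without a
    common point. *)
Lemma full_card_setI F R R' :
  meeting F -> r <= k -> 3 * k <= n -> \bigcap_(A in F) A = set0 ->
  #|R| = r -> #|R'| = r -> full F R -> full F R' -> r <= #|R :&: R'|.+1.
Proof.
move=> mF le_rk le_n F0 cR cR' fR fR'; rewrite leqNgt; apply/negP => lt_r.
have [g gP] := missing_set F0.
have [||A [kA sRA AR']] := @ksuperset_avoiding R R'; rewrite ?cR //.
  by rewrite cardsU; lia.
have cA : #|A| = k by move: kA; rewrite inE => /eqP.
have [||A' [kA' sRA' A'A]] := @ksuperset_avoiding R' A; rewrite ?cR' //.
  by rewrite cardsU; lia.
have AF : A \in F by apply: (subsetP fR); rewrite inE kA.
have A'F : A' \in F by apply: (subsetP fR'); rewrite inE kA'.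
have [||z /bigcapP zQ] := @meetingP F (A |: (A' |: g @: (R :&: R'))) mF.
- rewrite !subUset !sub1set AF A'F; apply/subsetP => _ /imsetP[x _ ->].
  by have [] := gP x.
- rewrite !cardsU1; apply: (@leq_trans (1 + (1 + #|R :&: R'|))); last by lia.
  by rewrite !leq_add ?leq_b1 ?leq_imset_card.
have zA : z \in A by apply: zQ; rewrite !inE eqxx.
have zA' : z \in A' by apply: zQ; rewrite !inE eqxx orbT.
have zR' : z \in R' by apply: (subsetP A'A); rewrite inE zA'.
have zR : z \in R by apply: (subsetP AR'); rewrite inE zA.
have [_ /negP] := gP z; apply; apply: zQ.
by rewrite !inE imset_f ?orbT // inE zR.
Qed.

(** If [P] has a point [w] outside [R :|: R'], then [P :\ w] lies in both [R] and [R']; having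
    [r.-1] points, it equals [R :&: R']. *)
Lemma setI_sub_or_sub_setU P R R' :
  #|P| = r -> #|R| = r -> #|R'| = r -> R != R' ->
  r <= #|P :&: R|.+1 -> r <= #|P :&: R'|.+1 ->
  P \subset R :|: R' \/ R :&: R' \subset P.
Proof.
move=> cP cR cR' neR PR PR'; have [|/subsetPn[w wP wN]] := boolP (P \subset _); [by left | right].
move: wN; rewrite inE negb_or => /andP[wR wR'].
have cPw : #|P :\ w| = r.-1 by rewrite cards_setD1 // cP.
have sPw (R2 : {set 'I_n}) : w \notin R2 -> r <= #|P :&: R2|.+1 -> P :\ w \subset R2.
  move=> wR2 cPR2; suff /eqP <- : P :&: R2 == P :\ w by apply: subsetIr.
  rewrite eqEcard cPw; apply/andP; split; last by lia.
  apply/subsetP => z; rewrite !inE => /andP[-> zR2]; rewrite andbT.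
  by apply: contraNneq wR2 => <-.
apply: subset_trans (subsetDl P [set w]).
suff /eqP -> : P :\ w == R :&: R' by [].
rewrite eqEcard; apply/andP; split; first by rewrite subsetI !sPw.
rewrite cPw -ltnS prednK; last first.
  by rewrite -cP; apply/card_gt0P; exists w.
rewrite -cR; apply: proper_card; rewrite properEneq subsetIl andbT.
apply: contra neR => /eqP/setIidPl sRR'; rewrite eqEcard sRR'.
by rewrite cR cR' leqnn.
Qed.

(** Take [X = R0 :|: R1] for distinct members [R0], [R1]. A member [R2] avoiding a point [c] of
    [R0 :&: R1] must be [X :\ c], and then every member lies in [X]. Each point of [X] is avoided by
    some member, which is its complement in [X]. *)
Lemma all_codim1_subsets (Rs : {set {set 'I_n}}) :
  1 < r -> Rs != set0 -> (forall R, R \in Rs -> #|R| = r) ->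
  (forall R R', R \in Rs -> R' \in Rs -> r <= #|R :&: R'|.+1) ->
  \bigcap_(R in Rs) R = set0 ->
  exists2 X : {set 'I_n}, #|X| = r + 1 & forall x, x \in X -> X :\ x \in Rs.
Proof.
move=> r_gt1 /set0Pn[R0 R0s] cRs RsI Rs0; have [g gP] := missing_set Rs0.
have [z0 z0R0] : exists z, z \in R0 by apply/card_gt0P; rewrite cRs //; lia.
have [R1s z0R1] := gP z0; move: (g z0) R1s z0R1 => R1 R1s z0R1.
have nR01 : R0 != R1 by apply: contraNneq z0R1 => <-.
have cI : #|R0 :&: R1| < r.
  rewrite -(cRs R0) //; apply: proper_card; rewrite properEneq subsetIl andbT.
  apply: contra nR01 => /eqP/setIidPl sR; rewrite eqEcard sR.
  by rewrite !cRs ?leqnn.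
have c01 := RsI _ _ R0s R1s.
pose X := R0 :|: R1; have cX : #|X| = r + 1.
  by rewrite cardsU (cRs R0) ?(cRs R1) //; lia.
have [c cI01] : exists c, c \in R0 :&: R1 by apply/card_gt0P; lia.
have /setIP[cR0 cR1] := cI01.
have [R2s cR2] := gP c; move: (g c) R2s cR2 => R2 R2s cR2.
have tri R R' P : R \in Rs -> R' \in Rs -> P \in Rs -> R != R' ->
    P \subset R :|: R' \/ R :&: R' \subset P.
  by move=> Rs_ R's Ps neR; apply: setI_sub_or_sub_setU => //; by [apply: cRs | apply: RsI].
have sR2X : R2 \subset X.
  have [//|/subsetP/(_ c cI01)] := tri R0 R1 R2 R0s R1s R2s nR01.
  by rewrite (negPf cR2).
have eqD P x : P \in Rs -> P \subset X -> x \in X -> x \notin P -> P = X :\ x.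
  move=> Ps sPX xX xP; apply/eqP; rewrite eqEcard cards_setD1 // cX addn1 cRs // leqnn andbT.
  apply/subsetP => z zP; rewrite !inE -in_setU (subsetP sPX) // andbT.
  by apply: contraNneq xP => <-.
have sX P : P \in Rs -> P \subset X.
  move=> Ps; apply/contraT => nPX.
  have sub R R' : R \in Rs -> R' \in Rs -> R != R' -> R \subset X ->
      R' \subset X -> R :&: R' \subset P.
    move=> Rs_ R's neR sR sR'; have [sP|//] := tri _ _ _ Rs_ R's Ps neR.
    by rewrite (subset_trans sP) ?subUset ?sR in nPX.
  have nR02 : R0 != R2 by apply: contraNneq cR2 => <-.
  have nR12 : R1 != R2 by apply: contraNneq cR2 => <-.
  have sR0X : R0 \subset X by apply: subsetUl.
  have sR1X : R1 \subset X by apply: subsetUr.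
  have eR2 : R2 = X :\ c by apply: eqD; rewrite // inE cR0.
  (* A member [P] not inside [X] would contain the pairwise intersections of [R0], [R1], [R2], which
     together cover [X]. *)
  suff: #|X| <= #|P| by rewrite cX cRs // addn1 ltnn.
  apply: subset_leq_card; apply/subsetP => x xX.
  have [x01|x01] := boolP (x \in R0 :&: R1).
    exact: (subsetP (sub _ _ R0s R1s nR01 sR0X sR1X)).
  have xR2 : x \in R2 by rewrite eR2 inE xX andbT inE; apply: contraNneq x01 => ->.
  move: xX; rewrite inE => /orP[xR|xR].
    by apply: (subsetP (sub _ _ R0s R2s nR02 sR0X sR2X)); rewrite inE xR.
  by apply: (subsetP (sub _ _ R1s R2s nR12 sR1X sR2X)); rewrite inE xR.
exists X => // x xX; have [gs xg] := gP x.
by rewrite -(eqD (g x)) // sX.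
Qed.

(** If [A] missed two points [ab] of [X], take for each of the other [r.-1] points [c] a superset of
    [X :\ c] in [F] meeting [A :|: X] only in [X :\ c]. A point common to these and [A] would lie in
    [ab], which is disjoint from [A]. *)
Lemma full_sub_famX F X :
  meeting F -> F \subset ksubsets n k -> 1 < r -> r <= k -> 4 * k <= n -> #|X| = r + 1 ->
  (forall x, x \in X -> full F (X :\ x)) -> F \subset famX X k.
Proof.
move=> mF Fk r_gt1 le_rk le_n cX fX; apply/subsetP => A AF.
have kA := subsetP Fk _ AF; have cA : #|A| = k by move: kA; rewrite inE => /eqP.
rewrite inE kA cX addnK /= leqNgt; apply/negP => lt_r.
have [ab sab cab] : exists2 C : {set 'I_n}, C \subset X :\: A & #|C| = 2.
  by apply: exists_subset_card; rewrite cardsD cX setIC ltn_subRL ltn_add2r.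
have cXab : #|X :\: ab| = r.-1.
  rewrite cardsD (setIidPr _) ?cX ?cab; first by lia.
  by apply: subset_trans sab _; apply: subsetDl.
have exB c : exists B, (c \in X) ==> [&& B \in F & B :&: (A :|: X) \subset X :\ c].
  have [cX_|] := boolP (c \in X); last by exists set0.
  have [||B [kB sB BA]] := @ksuperset_avoiding (X :\ c) (A :|: X); rewrite ?cards_setD1 ?cX //.
  - by rewrite addn1.
  - apply: leq_trans le_n; rewrite (setUidPr _); last first.
      by apply: subset_trans (subsetDl _ _) (subsetUr _ _).
    by rewrite cardsU cX cA; lia.
  by exists B; rewrite BA (subsetP (fX c cX_)) // inE kB.
pose B c := xchoose (exB c).
have BP c : c \in X -> B c \in F /\ B c :&: (A :|: X) \subset X :\ c.
  by move=> cX_; have /implyP/(_ cX_)/andP := xchooseP (exB c).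
have [||z /bigcapP zQ] := @meetingP F (A |: B @: (X :\: ab)) mF.
- rewrite subUset sub1set AF; apply/subsetP => _ /imsetP[c /setDP[cX_ _] ->].
  by have [] := BP c cX_.
- rewrite cardsU1; apply: (@leq_trans (1 + #|X :\: ab|)); last by rewrite cXab; lia.
  by rewrite !leq_add ?leq_b1 ?leq_imset_card.
have zA : z \in A by apply: zQ; rewrite !inE eqxx.
have zB c : c \in X :\: ab -> z \in X :\ c.
  move=> cab'; have /setDP[cX_ _] := cab'; have [_ /subsetP] := BP c cX_; apply.
  by rewrite !inE zA /= andbT; apply: zQ; rewrite inE imset_f ?orbT.
have [c /zB] : exists c, c \in X :\: ab by apply/card_gt0P; rewrite cXab; lia.
move=> /setD1P[_ zX].
have /zB : z \in X :\: ab.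
  rewrite inE zX andbT; apply/negP => /(subsetP sab).
  by rewrite inE zA.
by rewrite !inE eqxx.
Qed.

(** * Triangles with and without light members *)

Lemma sub_famX_of_triangle F T :
  meeting F -> F \subset ksubsets n k -> 1 < r -> r <= k -> 4 * k <= n ->
  T \in triangles (r + 1) F -> [disjoint T & light F] ->
  exists2 X : {set 'I_n}, #|X| = r + 1 & F \subset famX X k.
Proof.
move=> mF Fk r_gt1 le_rk le_n.
rewrite inE => /andP[TF /and3P[/eqP cT /eqP T0 _]] Tl.
have F0 : \bigcap_(A in F) A = set0.
  by apply/eqP; rewrite -subset0 -T0; apply/bigcapsP => A AT; apply/bigcap_inf/(subsetP TF).
pose Rs := [set R : {set 'I_n} | (#|R| == r) && full F R].
have exR A : A \in T -> exists2 R, R \in Rs & R \subset A.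
  move=> AT; have: A \notin light F by rewrite (disjointFr Tl AT).
  rewrite inE (subsetP TF) //= => /forallPn[R].
  by rewrite negb_imply negbK => /andP[/andP[sRA cR] fR]; exists R; rewrite ?inE ?cR.
have cRs R : R \in Rs -> #|R| = r by rewrite inE => /andP[/eqP].
have [A AT] : exists A, A \in T by apply/card_gt0P; rewrite cT addn1.
have [|||X cX RX] := @all_codim1_subsets Rs r_gt1 _ cRs.
- by have [R Rs_ _] := exR _ AT; apply/set0Pn; exists R.
- move=> R R'; rewrite !inE => /andP[/eqP cR fR] /andP[/eqP cR' fR'].
  by apply: (full_card_setI mF) => //; lia.
- apply/eqP; rewrite -subset0 -T0; apply/bigcapsP => B /exR[R Rs_ sRB].
  by apply: subset_trans sRB; apply: bigcap_inf.
exists X => //; apply: full_sub_famX => // x /RX.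
by rewrite inE => /andP[].
Qed.

Lemma card_triangles_light F :
  maximal_meeting F -> 1 < r -> r <= k -> k <= n ->
  (forall T, T \in triangles (r + 1) F -> ~~ [disjoint T & light F]) ->
  #|triangles (r + 1) F| <=
    k ^ (3 * r + 1) * 'C(n - r.+1, n - k) * 'C(n - r, n - k) ^ r.
Proof.
move=> maxF r_gt1 le_rk le_kn lightT; have /maxsetP[/andP[Fk mF] _] := maxF.
have [->|/set0Pn[T0]] := eqVneq (triangles (r + 1) F) set0; first by rewrite cards0.
rewrite inE => /andP[T0F /and3P[_ /eqP T00 _]].
have F0 : \bigcap_(A in F) A = set0.
  by apply/eqP; rewrite -subset0 -T00; apply/bigcapsP => A AT; apply/bigcap_inf/(subsetP T0F).
apply: (@leq_trans #|\bigcup_(A in light F) [set T in triangles (r + 1) F | A \in T]|).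
  apply: subset_leq_card; apply/subsetP => T TF.
  have := lightT _ TF; rewrite -setI_eq0 => /set0Pn[A /setIP[AT AL]].
  by apply/bigcupP; exists A; rewrite // inE TF.
apply: leq_trans (leq_card_bigcup _ _) _.
apply: leq_trans (leq_sum_const (d := k ^ r * (k * 'C(n - r, n - k)) ^ r) _) _.
  move=> A; rewrite inE => /andP[AF _].
  apply: card_triangles_through => //; first by rewrite ltnW.
  by move=> S cS; apply: card_degree.
apply: leq_trans (leq_mul (card_light maxF r_gt1 le_rk le_kn F0) (leqnn _)) _.
(* Of the exponent, [r.+1] comes from [card_light], one [r] from the choice of an [r]-subset and one
   [r] from the degree bound. *)
rewrite expnMn (_ : 3 * r + 1 = r.+1 + (r + r)); last by lia.
by rewrite !expnD; nia.
Qed.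

End Triangles.

Theorem theorem2 (n k r : nat) (F : {set {set 'I_n}})
    (hr : 3 <= r) (hk : r <= k) (hn : 4 * k ^ (r * (r + 1)) <= n)
    (hF : F \subset ksubsets n k) (hI : rwise_intersecting r F) :
  #|triangles (r + 1) F| <= num_triangles n (r + 1) k /\
  (#|triangles (r + 1) F| = num_triangles n (r + 1) k <->
   exists X : {set 'I_n},
     [/\ #|X| = r + 1, famX' X k \subset F & F \subset famX X k]).
Proof.
have le_4k : 4 * k <= n.
  apply: leq_trans hn; rewrite leq_mul2l -[X in X <= _]expn1 leq_pexp2l //; lia.
have r_gt1 : 1 < r := ltnW hr.
have mF : meeting r F by apply: rwise_intersecting_meeting => //; lia.
have [G maxG sFG] : {G | maximal_meeting k r G & F \subset G}.
  by apply: maxset_exists; rewrite hF.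
have /maxsetP[/andP[Gk mG] _] := maxG.
have eq_of_X (X : {set 'I_n}) : #|X| = r + 1 -> famX' X k \subset F -> F \subset famX X k ->
    #|triangles (r + 1) F| = num_triangles n (r + 1) k.
  by move=> cX sX'F sFX; rewrite (triangles_famX'_eq cX sX'F sFX) num_trianglesE.
suff [le_F eq_F] : #|triangles (r + 1) F| <= num_triangles n (r + 1) k /\
    (#|triangles (r + 1) F| = num_triangles n (r + 1) k -> exists X : {set 'I_n},
     [/\ #|X| = r + 1, famX' X k \subset F & F \subset famX X k]).
  by split=> //; split=> // -[X []]; apply: eq_of_X.
have le_FG := subset_leq_card (triangles_mono (r + 1) sFG).
have [/exists_inP[T TG Tl]|/exists_inPn noT] :=
    boolP [exists T in triangles (r + 1) G, [disjoint T & light k r G]].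
  have [X cX sGX] := sub_famX_of_triangle mG Gk r_gt1 hk le_4k TG Tl.
  have sFX := subset_trans sFG sGX.
  rewrite -(num_trianglesE k cX); split; first exact/subset_leq_card/triangles_mono.
  move=> eFX; exists X; split=> //.
  by apply: (triangles_famX_eqP _ hk _ cX sFX eFX); lia.
(* When every triangle of [G] has a light member, the bound is strict and equality cannot occur. *)
suff lt_G : #|triangles (r + 1) G| < num_triangles n (r + 1) k.
  have lt_F := leq_ltn_trans le_FG lt_G.
  by split=> [|eF]; [exact: ltnW | rewrite eF ltnn in lt_F].
have [|X _ cX] := @exists_subset_card _ [set: 'I_n] (r + 1).
  by rewrite cardsT card_ord; lia.
rewrite -(num_trianglesE k cX).
apply: leq_ltn_trans (card_triangles_light maxG r_gt1 hk _ noT) _; first by lia.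
apply: leq_trans (card_famX_triangles _ cX hk); last by lia.
exact: light_triangles_lt.
Qed.
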